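(* Let $K$ be a field and let $n,d$ be integers with $1\le d\le n-1$. Then the squarefree Veronese ideal $I_{n,d}\subset K[x_1,\ldots,x_n]$ is Freiman if and only if $d=1$ or $d=n-1$.
   Context: $I_{n,d}\subset S=K[x_1,\ldots,x_n]$ is the ideal generated by all squarefree monomials of degree $d$ in $x_1,\ldots,x_n$, i.e. with minimal monomial generators $x_1^{b_1}\cdots x_n^{b_n}$, $\sum_{i=1}^n b_i=d$, $0\le b_i\le 1$. For a graded ideal $I\subset S$, $\mu(I)$ denotes the minimal number of generators of $I$; the fiber cone is $F(I)=\bigoplus_{k\ge 0} I^k/\mathfrak m I^k$ with $\mathfrak m=(x_1,\ldots,x_n)$, and the analytic spread $\ell(I)$ is the Krull dimension of $F(I)$. A monomial ideal $I$ that is equigenerated (minimally generated by monomials of one degree) is called Freiman if $\mu(I^2)=\ell(I)\mu(I)-\binom{\ell(I)}{2}$. *)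

(* Defs.v *)
From HB Require Import structures.
From mathcomp Require Import all_boot all_algebra.
From mathcomp Require Import generic_quotient ring_quotient.
From mathcomp Require Import boolp classical_sets.
From mathcomp Require Import mpoly.

Set Implicit Arguments.
Unset Strict Implicit.
Unset Printing Implicit Defensive.

Import GRing.Theory.

Local Open Scope ring_scope.
Local Open Scope classical_set_scope.

Section Ideals.
Variable R : comNzRingType.
Implicit Types (A I J : set R) (f g : R).

Definition ideal_gen A : set R :=
  [set f | exists2 s : seq (R * R),
    forall p, p \in s -> A p.2 & f = \sum_(p <- s) p.1 * p.2].

Definition ideal_mul I J : set R := ideal_gen [set f * g | f in I & g in J].

Definition ideal_exp I k : set R := iter k (ideal_mul I) setT.

Definition min_gens_spec I (m : nat) : Prop :=
  (exists2 s : seq R, I = ideal_gen [set` s] & size s = m) /\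
  (forall s : seq R, I = ideal_gen [set` s] -> (m <= size s)%N).

(* Outside the finitely generated ideals, where min_gens_spec I is empty, mu I
   is the junk value 0. *)
Definition mu I : nat := xget 0%N (min_gens_spec I).

Lemma ideal_gen0 A : ideal_gen A 0.
Proof. by exists [::] => //; rewrite big_nil. Qed.

Lemma ideal_genD A f g : ideal_gen A f -> ideal_gen A g -> ideal_gen A (f + g).
Proof.
move=> [s sA ->] [t tA ->]; exists (s ++ t); last by rewrite big_cat.
by move=> p; rewrite mem_cat => /orP[/sA|/tA].
Qed.

Lemma ideal_genM A f g : ideal_gen A g -> ideal_gen A (f * g).
Proof.
move=> [s sA ->]; exists [seq (f * p.1, p.2) | p <- s].
  by move=> _ /mapP[p /sA Ap ->].
by rewrite big_map mulr_sumr; apply: eq_bigr => p _; rewrite mulrA.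
Qed.

Lemma mem_ideal_gen A f : A f -> ideal_gen A f.
Proof.
move=> Af; exists [:: (1, f)]; last by rewrite big_seq1 mul1r.
by move=> p; rewrite inE => /eqP ->.
Qed.

Lemma ideal_gen_ind A (B : R -> Prop) :
  B 0 -> (forall f g, B f -> B g -> B (f + g)) ->
  (forall f g, A g -> B (f * g)) -> forall f, ideal_gen A f -> B f.
Proof.
move=> B0 BD BM _ [s sA ->]; rewrite big_seq.
by apply: big_ind => // p /sA; apply: BM.
Qed.

Lemma ideal_exp_closed I k :
  [/\ ideal_exp I k 0,
      forall f g, ideal_exp I k f -> ideal_exp I k g -> ideal_exp I k (f + g)
    & forall f g, ideal_exp I k g -> ideal_exp I k (f * g)].
Proof.
case: k => [|k] //=.
by split; [exact: ideal_gen0 | exact: ideal_genD | exact: ideal_genM].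
Qed.

Lemma ideal_expM I j k f g :
  ideal_exp I j f -> ideal_exp I k g -> ideal_exp I (j + k) (f * g).
Proof.
move=> + Ig; elim: j f => [|j IHj] f If.
  by rewrite add0n; case: (ideal_exp_closed I k) => _ _; apply.
have [E0 ED EM] := ideal_exp_closed I (j.+1 + k).
move: f If; refine (ideal_gen_ind (B := fun f => ideal_exp I _ (f * g)) _ _ _).
- by rewrite /= mul0r.
- by move=> f1 f2 /= ? ?; rewrite mulrDl; apply: ED.
- move=> c _ [a Ia [b Ib <-]] /=; rewrite -!mulrA; apply: EM.
  by rewrite addSn; apply: mem_ideal_gen; exists a => //; exists (b * g) => //;
    apply: IHj.
Qed.

End Ideals.

Section KrullDimension.
Variable R : comNzRingType.

(* idealr_closed includes properness. *)
Definition prime_ideal (P : {pred R}) : Prop :=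
  idealr_closed P /\ prime_idealr_closed P.

Definition has_prime_chain (l : nat) : Prop :=
  exists P : nat -> {pred R},
    (forall i, (i <= l)%N -> prime_ideal (P i)) /\
    (forall i, (i < l)%N ->
       {subset P i <= P i.+1} /\ exists2 x, x \in P i.+1 & x \notin P i).

Definition krull_dim_spec (l : nat) : Prop :=
  has_prime_chain l /\ (forall l', has_prime_chain l' -> (l' <= l)%N).

(* Junk value 0 if the lengths of the chains of primes are unbounded; the fiber
   cones below are nonzero finitely generated algebras over a field, so for
   them krull_dim_spec is satisfied by a unique l. *)
Definition krull_dim : nat := xget 0%N krull_dim_spec.

End KrullDimension.

Section Rees.
Variables (R : comNzRingType) (I : set R).

Definition rees_pred : pred {poly R} :=
  [pred p : {poly R} | `[< forall k, ideal_exp I k p`_k >]].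

Lemma rees_subring : subring_closed rees_pred.
Proof.
have E k := ideal_exp_closed I k.
split=> [|p q /asboolP Ip /asboolP Iq|p q /asboolP Ip /asboolP Iq];
  apply/asboolP => k.
- by rewrite coef1; case: k => [|k] //=; exact: ideal_gen0.
- rewrite coefB; have [_ ED EM] := E k; apply: ED => //.
  by rewrite -mulN1r; apply: EM.
- rewrite coefM; have [E0 ED EM] := E k; apply: big_ind => // i _.
  by have := ideal_expM (Ip i) (Iq (k - i)%N); rewrite subnKC ?leq_ord.
Qed.

HB.instance Definition _ :=
  GRing.isSubringClosed.Build {poly R} rees_pred rees_subring.

(* The Rees algebra R[It], as the subring of R[t] of the polynomials whose
   t^k-coefficient lies in I^k. *)
Record rees := Rees { rees_val :> {poly R}; _ : rees_val \in rees_pred }.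

HB.instance Definition _ := [isSub for rees_val].
HB.instance Definition _ := [Choice of rees by <:].
HB.instance Definition _ := [SubChoice_isSubComNzRing of rees by <:].

End Rees.

Section PolynomialRing.
Variables (K : fieldType) (n : nat).
Local Notation S := {mpoly K[n]}.
Implicit Types I : set S.

Definition max_ideal : set S := ideal_gen [set 'X_i | i in [set: 'I_n]].

(* The ideal m S[It] of the Rees algebra, whose component of degree k is
   m I^k. *)
Definition fiber_pred I : pred (rees I) :=
  [pred p : rees I |
    `[< forall k, ideal_mul max_ideal (ideal_exp I k) (rees_val p)`_k >]].

Lemma max_ideal_coef0 (f : S) : max_ideal f -> f@_0%MM = 0.
Proof.
move: f; apply: ideal_gen_ind => [|f g f0 g0|f _ [i _ <-]].
- by rewrite mcoeff0.
- by rewrite mcoeffD f0 g0 addr0.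
- by rewrite rmorphM /= mcoeffX mnm1_eq0 mulr0.
Qed.

Lemma fiber_idealr I : idealr_closed (@fiber_pred I).
Proof.
split=> [||a u v /asboolP Fu /asboolP Fv].
- by apply/asboolP => k; rewrite coef0; exact: ideal_gen0.
- apply/asboolPn => F1; have := F1 0%N; rewrite coef1 /=.
  move=> m1; have : (1 : S)@_0%MM = 0.
    move: 1 m1; apply: ideal_gen_ind => [|f g f0 g0|f _ [g mg [h _ <-]]].
    + by rewrite mcoeff0.
    + by rewrite mcoeffD f0 g0 addr0.
    + by rewrite !rmorphM /= (max_ideal_coef0 mg) mul0r mulr0.
  by rewrite mcoeff1 eqxx => /eqP; rewrite oner_eq0.
- apply/asboolP => k; rewrite coefD coefM; apply: ideal_genD (Fv k).
  apply: big_ind => [|x y|i _]; [exact: ideal_gen0|exact: ideal_genD|].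
  have /asboolP Ia := valP a.
  move: (u : {poly S})`_(k - i) (Fu (k - i)%N).
  refine (ideal_gen_ind (B := fun w => ideal_mul _ _ (_ * w)) _ _ _) => /=.
  + by rewrite mulr0; exact: ideal_gen0.
  + by move=> f g ? ?; rewrite mulrDr; exact: ideal_genD.
  + move=> f _ [g mg [h Ih <-]]; rewrite mulrCA; apply: ideal_genM.
    apply: mem_ideal_gen; exists g => //; exists ((a : {poly S})`_i * h).
      by have := ideal_expM (Ia i) Ih; rewrite subnKC ?leq_ord.
    by rewrite mulrCA.
Qed.

HB.instance Definition _ I :=
  isIdealr.Build (rees I) (@fiber_pred I) (@fiber_idealr I).

Definition fiber_ideal I : idealr (rees I) := @fiber_pred I.

(* S[It] / m S[It] is the direct sum of the I^k / m I^k. *)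
Definition fiber_cone I : comNzRingType := {ideal_quot (fiber_ideal I)}.

Definition analytic_spread I : nat := krull_dim (fiber_cone I).

(* Distinct monomials of one degree never divide each other, so the generating
   set M is automatically the minimal one. *)
Definition equigenerated_monomial I : Prop :=
  exists (e : nat) (M : set 'X_{1..n}),
    (forall m, M m -> mdeg m = e) /\
    I = ideal_gen [set ('X_[m] : S) | m in M].

Definition freiman I : Prop :=
  equigenerated_monomial I /\
  (mu (ideal_exp I 2))%:Z =
    (analytic_spread I)%:Z * (mu I)%:Z - 'C(analytic_spread I, 2)%:Z.

Definition squarefree_veronese (d : nat) : set S :=
  ideal_gen [set ('X_[b] : S) |
    b in [set b : 'X_{1..n} | mdeg b = d /\ forall i, (b i <= 1)%N]].

End PolynomialRing.

Arguments max_ideal : clear implicits.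
Arguments squarefree_veronese : clear implicits.

(* Main.v *)
Require Import Defs.
From HB Require Import structures.
From mathcomp Require Import all_boot all_algebra.
From mathcomp Require Import generic_quotient ring_quotient.
From mathcomp Require Import boolp classical_sets.
From mathcomp Require Import mpoly.
From mathcomp Require Import zify ring.

(** Write I for the squarefree Veronese ideal of degree d, with 1 <= d <= n - 1.
    Three numbers enter the Freiman equation.

    - mu(I) = C(n, d). For an ideal generated by monomials of one degree e,
      reading off the coefficients at these monomials kills m I, so that any
      generating set yields a factorization of an identity matrix through its
      own size ([mu_mon_ideal]).

    - mu(I^2) is the number of exponent vectors of degree 2d with entries in
      {0, 1, 2}. Such a vector is determined by the set A of its twos and the
      set B of its ones, and all of them occur since B can be halved; hence
      mu(I^2) = \sum_j C(n, j) C(n - j, 2 (d - j)), j being the size of A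
      ([mu_squarefree_veronese_sqr]).

    - The analytic spread is n. The Rees algebra is the semigroup algebra of
      the pairs (k, a) with X^a in I^k, and its quotient by m S[It] retains the
      pairs with deg a = d k; setting t = 1 embeds it into K[x_1..x_n]
      ([toric_map_inj]). Elements chosen in the successive differences of a
      chain of primes are algebraically independent ([prime_chain_alg_indep]),
      and more than n polynomials in n variables never are ([alg_dependent]),
      whence dimension <= n. Conversely, projecting onto a face of the
      semigroup is a ring morphism with values in a domain, so a flag of faces
      produces a chain of primes; the flag used here successively imposes
      a_i = k for the d - 1 first coordinates, and then a_i = 0 for the
      others.

    The theorem is then the numerical claim that
    mu(I^2) + C(n, 2) >= n C(n, d), with equality only for d = 1 and d = n - 1.
    For the strict inequality the three terms j = d, d - 1, d - 2 of the sum
    are enough: the first two add up to C(n, d) (1 + d (n - d) / 2), which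
    together with C(n, 2) is exactly n C(n, d) when d = 2 or d = n - 2, and the
    third one is positive ([sqr_count_gt]). *)

Set Implicit Arguments.
Unset Strict Implicit.
Unset Printing Implicit Defensive.

Import GRing.Theory.

Local Open Scope ring_scope.
Local Open Scope classical_set_scope.

(** * Restricting a polynomial to a set of monomials *)

Section MonomialRestriction.
Variables (R : comNzRingType) (n : nat).
Implicit Types (P Q : pred 'X_{1..n}) (f g : {mpoly R[n]}).

Definition mrestr P f : {mpoly R[n]} :=
  \sum_(m <- msupp f | P m) f@_m *: 'X_[m].

Lemma mcoeff_mrestr P f m : (mrestr P f)@_m = if P m then f@_m else 0.
Proof.
rewrite raddf_sum /=.
under eq_bigr => k _ do rewrite mcoeffZ mcoeffX.
have [mf|mf] := boolP (m \in msupp f); last first.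
  rewrite (memN_msupp_eq0 mf) if_same big1_seq // => k /andP[_ kf].
  by case: eqP => [km|_]; [rewrite -km kf in mf | rewrite mulr0].
case: ifP => Pm.
  rewrite big_mkcond (bigD1_seq m) //= ?msupp_uniq // Pm eqxx mulr1.
  by rewrite big1 ?addr0 // => k /negPf->; case: ifP => _; rewrite ?mulr0.
by rewrite big1 // => k Pk; case: eqP => [km|_]; [rewrite km Pm in Pk | rewrite mulr0].
Qed.

Fact mrestr_is_zmod_morphism P : zmod_morphism (mrestr P).
Proof.
move=> f g; apply/mpolyP => m.
by rewrite mcoeffB !mcoeff_mrestr mcoeffB; case: ifP => _; rewrite ?subrr.
Qed.

HB.instance Definition _ P :=
  GRing.isZmodMorphism.Build _ _ (mrestr P) (mrestr_is_zmod_morphism P).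

Lemma mrestrZ P c f : mrestr P (c *: f) = c *: mrestr P f.
Proof.
apply/mpolyP => m; rewrite mcoeffZ !mcoeff_mrestr mcoeffZ.
by case: ifP; rewrite ?mulr0.
Qed.

Lemma mrestrX P m : mrestr P 'X_[m] = if P m then 'X_[m] else 0.
Proof.
apply/mpolyP => k; rewrite mcoeff_mrestr [in RHS]fun_if mcoeffX mcoeff0.
by case: eqP => [->|] //; rewrite !if_same.
Qed.

(** Restriction is multiplicative as soon as the sets of monomials are compatible
    with addition on the two supports alone. This covers both the component of
    lowest degree of a product and the projection onto a face of a semigroup. *)
Lemma mrestr_mul (P Q T : pred 'X_{1..n}) f g :
  (forall a b, a \in msupp f -> b \in msupp g -> T (a + b)%MM = P a && Q b) ->
  mrestr T (f * g) = mrestr P f * mrestr Q g.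
Proof.
move=> PQ; rewrite {1}(mpolyE f) {1}(mpolyE g) !big_distrlr /= raddf_sum /=.
rewrite [RHS]big_mkcond; apply: eq_big_seq => a af.
rewrite raddf_sum /=; case: ifP => Pa.
  rewrite [RHS]big_mkcond; apply: eq_big_seq => b bg.
  rewrite -scalerAl -scalerAr -mpolyXD !mrestrZ mrestrX PQ // Pa /=.
  by case: ifP => _; rewrite ?scaler0 // mpolyXD -scalerAl -scalerAr.
rewrite big1_seq // => b /= bg.
by rewrite -scalerAl -scalerAr -mpolyXD !mrestrZ mrestrX PQ // Pa !scaler0.
Qed.

End MonomialRestriction.

(** * Monomial ideals *)

Section IdealGen.
Variable R : comNzRingType.
Implicit Types A B : set R.

Lemma ideal_gen_sub A B :
  (forall f, A f -> ideal_gen B f) -> forall f, ideal_gen A f -> ideal_gen B f.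
Proof.
move=> AB; apply: ideal_gen_ind; first exact: ideal_gen0.
- by move=> f g; exact: ideal_genD.
- by move=> f g /AB; exact: ideal_genM.
Qed.

Lemma ideal_mul_gen A B :
  ideal_mul (ideal_gen A) (ideal_gen B) = ideal_gen [set f * g | f in A & g in B].
Proof.
apply/seteqP; split; apply: ideal_gen_sub => _ [f Af [g Bg <-]].
  move: f Af; apply: (ideal_gen_ind (B := fun f => ideal_gen _ (f * g))).
  - by rewrite mul0r; exact: ideal_gen0.
  - by move=> f1 f2 ? ?; rewrite mulrDl; exact: ideal_genD.
  move=> c f Af; rewrite -mulrA; apply: ideal_genM.
  move: g Bg; apply: (ideal_gen_ind (B := fun g => ideal_gen _ (f * g))).
  - by rewrite mulr0; exact: ideal_gen0.
  - by move=> f1 f2 ? ?; rewrite mulrDr; exact: ideal_genD.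
  by move=> b g Bg; rewrite mulrCA; apply: ideal_genM;
     apply: mem_ideal_gen; exists f => //; exists g.
by apply: mem_ideal_gen; exists f; [exact: mem_ideal_gen|];
   exists g => //; exact: mem_ideal_gen.
Qed.

Lemma ideal_gen_seqP (s : seq R) f :
  ideal_gen [set` s] f -> exists q : 'I_(size s) -> R, f = \sum_j q j * s`_j.
Proof.
move: f; apply: ideal_gen_ind => [|f g [q ->] [r ->]|c g /= sg].
- by exists (fun=> 0); rewrite big1 // => j _; rewrite mul0r.
- exists (fun j => q j + r j); rewrite -big_split.
  by apply: eq_bigr => j _; rewrite mulrDl.
- have gs : (index g s < size s)%N by rewrite index_mem.
  exists (fun j => if j == Ordinal gs then c else 0).
  rewrite (bigD1 (Ordinal gs)) //= eqxx nth_index // big1 ?addr0 // => j /negPf->.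
  by rewrite mul0r.
Qed.

End IdealGen.

Section MonomialIdeals.
Variables (K : fieldType) (n : nat).
Local Notation S := {mpoly K[n]}.
Implicit Types (M N : set 'X_{1..n}) (f g : S).

Definition mon_ideal M : set S := ideal_gen [set ('X_[m] : S) | m in M].

Lemma mon_idealP M f :
  mon_ideal M f <->
  (forall a, a \in msupp f -> exists2 m, M m & (m <= a)%MM).
Proof.
split.
  move: f; apply: ideal_gen_ind => [|f g IHf IHg|c _ [m Mm <-]] a.
  - by rewrite msupp0.
  - by move/msuppD_le; rewrite mem_cat => /orP[/IHf|/IHg].
  - by rewrite (perm_mem (msuppMX _ _)) => /mapP[b _ ->]; exists m => //;
      rewrite lem_addr.
move=> Mf; rewrite (mpolyE f) big_seq; apply: big_ind.
- exact: ideal_gen0.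
- by move=> ? ?; exact: ideal_genD.
move=> a /Mf[m Mm ma]; rewrite -(submK ma) mpolyXD -mul_mpolyC mulrA.
by apply: ideal_genM; apply: mem_ideal_gen; exists m.
Qed.

Lemma mon_ideal_mul M N :
  ideal_mul (mon_ideal M) (mon_ideal N) =
  mon_ideal [set (a + b)%MM | a in M & b in N].
Proof.
rewrite /mon_ideal ideal_mul_gen; congr ideal_gen; apply/seteqP; split => f /=.
  move=> [_ [a Ma <-] [_ [b Nb <-] <-]]; exists (a + b)%MM; last exact: mpolyXD.
  by exists a => //; exists b.
move=> [_ [a Ma [b Nb <-]] <-]; exists 'X_[a]; first by exists a.
by exists 'X_[b]; [exists b | rewrite mpolyXD].
Qed.

Definition mon_pow M k : set 'X_{1..n} :=
  iter k (fun N => [set (a + b)%MM | a in M & b in N]) [set 0%MM].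

Lemma mon_ideal_exp M k : ideal_exp (mon_ideal M) k = mon_ideal (mon_pow M k).
Proof.
elim: k => [|k IHk]; last by rewrite [LHS]/= -/(ideal_exp _ k) IHk mon_ideal_mul.
apply/seteqP; split => // f _; apply/mon_idealP => a _.
by exists 0%MM => //; apply/mnm_lepP => i; rewrite mnm0E.
Qed.

Lemma max_idealE : max_ideal K n = mon_ideal [set U_(i)%MM | i in [set: 'I_n]].
Proof.
congr ideal_gen; apply/seteqP; split => f /= [].
  by move=> i _ <-; exists U_(i)%MM => //; exists i.
by move=> _ [i _ <-] <-; exists i.
Qed.

(** All monomials of the ideal I have degree at least e, so the coefficient of
    q * g at a monomial of degree e, for g in I, is the constant coefficient of
    q times that of g. Writing each X^(m x) in terms of a generating set s and
    taking coefficients therefore factors the identity matrix of size #|A|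
    through a space of dimension [size s]. *)
Lemma mu_mon_ideal (T : finType) (A : {set T}) (m : T -> 'X_{1..n}) e :
  {in A &, injective m} -> {in A, forall x, mdeg (m x) = e} ->
  mu (mon_ideal [set m x | x in [set` A]]) = #|A|.
Proof.
move=> m_inj m_deg; set I := mon_ideal _.
have low f a : I f -> a \in msupp f -> (e <= mdeg a)%N.
  move=> /mon_idealP If /If[_ [x /= Ax <-] xa].
  by rewrite -(m_deg x Ax) -(submK xa) mdegD leq_addl.
suff spec : min_gens_spec I #|A|.
  rewrite /mu; apply: xget_unique => // j [[s Is <-] min_s].
  case: spec => -[t It tA] min_t; apply/eqP.
  by rewrite eqn_leq min_t // andbT -tA min_s.
split=> [|s Is].
  exists [seq 'X_[m x] | x <- enum A]; last by rewrite size_map cardE.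
  congr ideal_gen; apply/seteqP; split => f /=.
    by move=> [_ [x Ax <-] <-]; apply/mapP; exists x; rewrite ?mem_enum.
  move=> /mapP[x xA ->]; exists (m x) => //; exists x => //.
  by rewrite -mem_enum.
have/choice[q qE] (i : 'I_#|A|) :
    exists q : 'I_(size s) -> S, 'X_[m (enum_val i)] = \sum_j q j * s`_j.
  apply: ideal_gen_seqP; rewrite -Is; apply: mem_ideal_gen.
  by exists (m (enum_val i)) => //; exists (enum_val i) => //; exact: enum_valP.
pose Q := \matrix_(i < #|A|, j < size s) (q i j)@_0.
pose G := \matrix_(j < size s, i < #|A|) (s`_j)@_(m (enum_val i)).
apply: (@mulmx1_min K _ _ Q G); apply/matrixP => i k; rewrite !mxE.
transitivity ('X_[m (enum_val i)] : S)@_(m (enum_val k)); last first.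
  rewrite mcoeffX; congr (nat_of_bool _)%:R; apply/eqP/eqP => [|->//].
  by move/m_inj => /(_ (enum_valP i) (enum_valP k)) /enum_val_inj.
rewrite qE raddf_sum /=; apply: eq_bigr => j _; rewrite !mxE; symmetry.
have km : mdeg (m (enum_val k)) = e by rewrite m_deg ?enum_valP.
have Is_j : I s`_j by rewrite Is; apply: mem_ideal_gen; exact: mem_nth.
transitivity (mrestr (fun a => mdeg a == e) (q i j * s`_j))@_(m (enum_val k)).
  by rewrite mcoeff_mrestr km eqxx.
rewrite (@mrestr_mul _ _ (fun a => a == 0%MM) (fun a => mdeg a == e)); last first.
  move=> a b _ /(low _ _ Is_j) eb; rewrite mdegD -mdeg_eq0.
  by apply/eqP/andP => [|[/eqP-> /eqP->]] //; lia.
suff -> : mrestr (fun a => a == 0%MM) (q i j) = ((q i j)@_0)%:MP.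
  by rewrite mcoeffCM mcoeff_mrestr km eqxx.
apply/mpolyP => a; rewrite mcoeff_mrestr mcoeffC.
by case: eqP => [->|]; rewrite ?mulr1 ?mulr0.
Qed.

End MonomialIdeals.

Arguments mon_ideal K {n} M.

(** * Generators of the squarefree Veronese ideal and of its square *)

Section SetPairs.
Variable T : finType.
Implicit Types A B U V : {set T}.
Local Open Scope nat_scope.

(** The pair (A, B) stands for the exponent vector of degree 2d that is 2 on A,
    1 on B and 0 elsewhere. *)
Definition two_one_pairs d : {set {set T} * {set T}} :=
  [set AB : {set T} * {set T} | (AB.2 \subset ~: AB.1) && (2 * #|AB.1| + #|AB.2| == 2 * d)]%SET.

Lemma card_two_one_pairs d :
  #|two_one_pairs d| =
  \sum_(j < d.+1) 'C(#|T|, j) * 'C(#|T| - j, 2 * (d - j)).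
Proof.
rewrite -sum1_card (eq_bigl (fun AB : {set T} * {set T} =>
    (#|AB.1| < d.+1) && ((AB.2 \subset ~: AB.1) && (#|AB.2| == 2 * (d - #|AB.1|))))).
  rewrite -(pair_big_dep (fun A : {set T} => #|A| < d.+1)
    (fun A B : {set T} => (B \subset ~: A) && (#|B| == 2 * (d - #|A|)))
    (fun _ _ => 1)) /=.
  rewrite (partition_big (fun A : {set T} => inord #|A| : 'I_d.+1) predT) //=; apply: eq_bigr => j _.
  rewrite -(card_draws T j) -sum1_card big_distrl /=.
  apply: eq_big => [A|A /andP[Ad /eqP <-]].
    rewrite inE; apply/andP/eqP => [[Ad /eqP<-]|Aj]; first by rewrite inordK.
    by rewrite Aj inord_val.
  rewrite inordK // mul1n.
  have -> : #|T| - #|A| = #|~: A|%SET by rewrite [RHS]cardsCs finset.setCK.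
  by rewrite -cards_draws -[RHS]sum1_card;
     apply: eq_bigl => B; rewrite inE.
move=> [A B]; rewrite inE /=; case: (B \subset ~: A); rewrite ?andbF //=.
by apply/eqP/andP => [|[? /eqP]]; [split; [|apply/eqP]|]; lia.
Qed.

(** The product of the squarefree monomials of U and V is 2 on the intersection
    and 1 on the symmetric difference. Conversely B has even size
    2 (d - #|A|), and any half of it can be given to U, the other one to V. *)
Lemma two_one_pairs_imset d :
  two_one_pairs d =
  [set (U :&: V, (U :\: V) :|: (V :\: U)) |
     U in [set U : {set T} | #|U| == d], V in [set V : {set T} | #|V| == d]]%SET.
Proof.
apply/finset.setP => -[A B]; rewrite inE /=; apply/idP/imset2P; last first.
  move=> [U V /[!inE] /eqP Ud /eqP Vd [-> ->]]; apply/andP; split.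
    by apply/fintype.subsetP => i; rewrite !inE; do 2!case: (_ \in _).
  rewrite cardsU !cardsD [(V :&: U)%SET]finset.setIC Ud Vd.
  rewrite (_ : (U :\: V) :&: (V :\: U) = finset.set0)%SET; last first.
    by apply/finset.setP => i; rewrite !inE; do 2!case: (_ \in _).
  by rewrite cards0; have := subset_leq_card (finset.subsetIl U V); lia.
move=> /andP[/fintype.subsetP BA /eqP ABd].
have [B1 B1B cB1] : exists2 B1 : {set T}, B1 \subset B & #|B1| = d - #|A|.
  have : 0 < 'C(#|B|, d - #|A|) by rewrite bin_gt0; lia.
  by rewrite -cards_draws => /card_gt0P[C]; rewrite inE => /andP[? /eqP ?]; exists C.
have cB2 : #|(B :\: B1)%SET| = d - #|A| by rewrite cardsD (finset.setIidPr B1B); lia.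
have memB i : i \in B1 -> i \in B by move/(fintype.subsetP B1B).
have BnA i : i \in B -> i \notin A by move/BA; rewrite inE.
exists (A :|: B1)%SET (A :|: (B :\: B1))%SET.
- rewrite inE cardsU cB1 (_ : A :&: _ = finset.set0)%SET ?cards0; first lia.
  by apply/finset.setP => i; rewrite !inE; apply/negP => /andP[Ai /memB/BnA/negP].
- rewrite inE cardsU cB2 (_ : A :&: _ = finset.set0)%SET ?cards0; first lia.
  by apply/finset.setP => i; rewrite !inE; apply/negP => /and3P[Ai _ /BnA/negP].
congr pair; apply/finset.setP => i; rewrite !inE;
  by have /implyP := memB i; have /implyP := BnA i; do 3!case: (_ \in _).
Qed.

End SetPairs.

Section VeroneseGenerators.
Variables (K : fieldType) (n : nat).

Definition subsets_of_card d : {set {set 'I_n}} := [set A : {set 'I_n} | #|A| == d]%SET.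

Lemma squarefree_monomials d :
  [set b : 'X_{1..n} | mdeg b = d /\ forall i, (b i <= 1)%N] =
  [set mesym1 A | A in [set` subsets_of_card d]].
Proof.
apply/seteqP; split => b /=.
  move=> [bd b1]; have : mechar d b by rewrite /mechar bd eqxx; apply/forallP.
  by rewrite mecharP => /existsP[A /andP[/eqP-> Ad]]; exists A => //; rewrite inE.
by move=> [A + <-]; rewrite inE mdeg_mesym1 => /eqP ->; split=> // i;
   rewrite mnmE leq_b1.
Qed.

Lemma squarefree_veroneseE d :
  squarefree_veronese K n d = mon_ideal K [set mesym1 A | A in [set` subsets_of_card d]].
Proof. by rewrite /squarefree_veronese squarefree_monomials. Qed.

Lemma mu_squarefree_veronese d : mu (squarefree_veronese K n d) = 'C(n, d).
Proof.
rewrite squarefree_veroneseE (@mu_mon_ideal _ _ _ _ _ d).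
- by rewrite card_draws card_ord.
- by move=> A B _ _; exact: inj_mesym1.
- by move=> A; rewrite inE mdeg_mesym1 => /eqP.
Qed.

Definition two_one_mnm (AB : {set 'I_n} * {set 'I_n}) : 'X_{1..n} :=
  (mesym1 AB.1 + (mesym1 AB.1 + mesym1 AB.2))%MM.

Lemma squarefree_monomials_sqr d :
  mon_pow [set mesym1 A | A in [set` subsets_of_card d]] 2 =
  [set two_one_mnm AB | AB in [set` two_one_pairs 'I_n d]].
Proof.
have mesym1D (U V : {set 'I_n}) :
    two_one_mnm (U :&: V, (U :\: V) :|: (V :\: U))%SET = (mesym1 U + mesym1 V)%MM.
  by apply/mnmP => i; rewrite !mnmE !inE; do 2!case: (_ \in _).
rewrite two_one_pairs_imset; apply/seteqP; split => b /=.
  move=> [_ [U Ud <-] [_ [_ [V Vd <-] [_ -> <-]] <-]]; rewrite addm0 -mesym1D.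
  exists (U :&: V, (U :\: V) :|: (V :\: U))%SET => //.
  by apply/imset2P; exists U V.
move=> [_ /imset2P[U V Ud Vd ->] <-]; rewrite mesym1D.
exists (mesym1 U); first by exists U.
exists (mesym1 V); [exists (mesym1 V); [by exists V|]|by []].
by exists 0%MM; rewrite ?addm0.
Qed.

Lemma mu_squarefree_veronese_sqr d :
  mu (ideal_exp (squarefree_veronese K n d) 2) =
  (\sum_(j < d.+1) 'C(n, j) * 'C(n - j, 2 * (d - j)))%N.
Proof.
rewrite squarefree_veroneseE mon_ideal_exp squarefree_monomials_sqr.
rewrite (@mu_mon_ideal _ _ _ _ _ (2 * d)%N).
- by rewrite card_two_one_pairs card_ord.
- move=> [A B] [A' B'] /[!inE]/= /andP[/fintype.subsetP BA _] /andP[/fintype.subsetP BA' _].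
  move=> /mnmP eqAB; suff [eqA eqB] : A =i A' /\ B =i B'.
    by congr pair; apply/finset.setP.
  have eqi i : (i \in A) = (i \in A') /\ (i \in B) = (i \in B').
    have := eqAB i; have /implyP := BA i; have /implyP := BA' i.
    by rewrite !mnmE !inE; do 4!case: (_ \in _).
  by split => i; have [] := eqi i.
- move=> [A B] /[!inE]/= /andP[_ /eqP<-]; rewrite !mdegD !mdeg_mesym1 /=; lia.
Qed.

End VeroneseGenerators.

(** * Chains of prime ideals and algebraic independence *)

Section PrimeChains.
Variables (K : fieldType) (R : comNzRingType) (iota : {rmorphism K -> R}).
Implicit Type P : {pred R}.

Lemma prime_ideal0 P : prime_ideal P -> 0 \in P.
Proof. by move=> [[]]. Qed.

Lemma prime_idealD P : prime_ideal P -> {in P &, forall u v, u + v \in P}.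
Proof. by move=> [[_ _ PD] _] u v Pu Pv; rewrite -[u]mul1r PD. Qed.

Lemma prime_idealM P : prime_ideal P -> forall a u, u \in P -> a * u \in P.
Proof.
by move=> Pp a u Pu; have [[P0 _ PD] _] := Pp; rewrite -[a * u]addr0 PD.
Qed.

Lemma prime_ideal_const P c : prime_ideal P -> iota c \in P -> c = 0.
Proof.
move=> Pp Pc; apply/eqP/negP => /negP c0; have [[_ /negP P1 _] _] := Pp.
by apply: P1; rewrite -(rmorph1 iota) -(mulVf c0) rmorphM prime_idealM.
Qed.

Lemma prime_ideal_cancel P x u k :
  prime_ideal P -> x \notin P -> x ^+ k * u \in P -> u \in P.
Proof.
move=> [_ PM] xP; elim: k => [|k IHk]; first by rewrite mul1r.
by rewrite exprS -mulrA => /PM; rewrite (negPf xP).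
Qed.

(** Algebraic independence of x_0, ..., x_(l-1) modulo P_0, by induction on l. In
    a relation, factor out the least power of x_0 that occurs; as x_0 is not in
    the prime P_0, the cofactor is in P_0, hence in P_1. Since x_0 is in P_1,
    only the terms of the cofactor free of x_0 remain there, and they form a
    relation between x_1, ..., x_(l-1) modulo P_1. The polynomial is a family
    of coefficients c and exponents e over a finite type J, so that passing
    from l.+1 to l variables only changes c and e; distinctness of exponents
    is required on the support of c, which shrinks in the process. *)
Lemma prime_chain_alg_indep l (P : nat -> {pred R}) (x : 'I_l -> R)
    (J : finType) (e : J -> 'I_l -> nat) (c : J -> K) :
  (forall i, (i <= l)%N -> prime_ideal (P i)) ->
  (forall i, (i < l)%N -> {subset P i <= P i.+1}) ->
  (forall i : 'I_l, x i \in P i.+1 /\ x i \notin P i) ->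
  (forall j k, c j != 0 -> c k != 0 -> e j =1 e k -> j = k) ->
  \sum_j iota (c j) * \prod_i x i ^+ e j i \in P 0%N ->
  forall j, c j = 0.
Proof.
elim: l => [|l IHl] in P x e c * => Pprime Psub Px e_inj sumP.
  move=> j; have [//|cj] := eqVneq (c j) 0.
  apply: (prime_ideal_const (Pprime 0%N (leqnn _))).
  suff <- : \sum_j0 iota (c j0) * \prod_i x i ^+ e j0 i = iota (c j) by [].
  rewrite (bigD1 j) //= big_ord0 mulr1 big1 ?addr0 // => k kj.
  have [->|ck] := eqVneq (c k) 0; first by rewrite rmorph0 mul0r.
  by case/eqP: kj; apply: e_inj => // -[].
suff noc : forall j, ~~ (c j != 0) by move=> j; apply/eqP/negPn/noc.
move=> j0; apply/negP => cj0.
have [j cj j_min] := @arg_minnP _ j0 (fun j => c j != 0) (fun j => e j ord0) cj0.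
have P0 := Pprime 0%N (leq0n _); have P1 := Pprime 1%N (ltn0Sn _).
have [xP1 xP0] := Px ord0.
pose c' k := if e k ord0 == e j ord0 then c k else 0.
pose y k := \prod_i x (lift ord0 i) ^+ e k (lift ord0 i).
pose z := \sum_(k | (c k != 0) && (e j ord0 < e k ord0)%N)
  iota (c k) * (x ord0 ^+ (e k ord0 - e j ord0).-1 * y k).
have c'0 k : c' k = 0.
  apply: (IHl (fun i => P i.+1) (x \o lift ord0) (fun k => e k \o lift ord0)).
  - by move=> i il; exact: Pprime.
  - by move=> i il; exact: Psub.
  - by move=> i; exact: Px (lift ord0 i).
  - move=> k1 k2; rewrite /c'; case: ifP => [/eqP k1j ck1|]; last by rewrite eqxx.
    case: ifP => [/eqP k2j ck2 ek|]; last by rewrite eqxx.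
    apply: e_inj => // i; have [i' ->|->] := unliftP ord0 i; last by rewrite k1j.
    exact: ek.
  (* y k is the monomial of index k deprived of x_0; z gathers the terms with a
     higher power of x_0, with one factor x_0 taken out. *)
  have sumE : \sum_j0 iota (c j0) * \prod_i x i ^+ e j0 i =
      x ord0 ^+ e j ord0 * (\sum_k iota (c' k) * y k + x ord0 * z).
    rewrite mulrDr !mulr_sumr [X in _ = _ + X]big_mkcond -big_split /=.
    apply: eq_bigr => k1 _; rewrite big_ord_recl -/(y k1) /c'.
    case: (eqVneq (c k1) 0) => [->|ck1] /=.
      by rewrite if_same rmorph0 !(mul0r, mulr0) addr0.
    have := j_min k1 ck1; rewrite leq_eqVlt eq_sym.
    case: eqP => [-> _|_ /= lt]; first by rewrite ltnn addr0; ring.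
    rewrite lt rmorph0 mul0r mulr0 add0r.
    have -> : e k1 ord0 = (e j ord0 + (e k1 ord0 - e j ord0).-1.+1)%N by lia.
    rewrite addKn exprD exprS /=; ring.
  move: sumP; rewrite sumE => /(prime_ideal_cancel P0 xP0) /(Psub 0%N (ltn0Sn _)).
  set s := \sum_k _ => sz; rewrite /= -/s.
  have -> : s = (s + x ord0 * z) + (- z) * x ord0 by ring.
  by apply: prime_idealD => //; exact: prime_idealM.
by have := c'0 j; rewrite /c' eqxx => /eqP; rewrite (negPf cj).
Qed.

End PrimeChains.

Section AlgebraicDependence.
Variables (K : fieldType) (n : nat).
Local Notation S := {mpoly K[n]}.

Definition deg_le (D : nat) (f : S) : Prop :=
  forall a, a \in msupp f -> (mdeg a <= D)%N.

Lemma deg_leM D E f g : deg_le D f -> deg_le E g -> deg_le (D + E) (f * g).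
Proof.
move=> fD gE a /msuppM_le/allpairsP[[b c] /= [/fD bD /gE cE ->]].
by rewrite mdegD leq_add.
Qed.

Lemma deg_le1 D : deg_le D 1.
Proof. by move=> a; rewrite msupp1 inE => /eqP->; rewrite mdeg0. Qed.

Lemma deg_leX D f k : deg_le D f -> deg_le (k * D) (f ^+ k).
Proof.
move=> fD; elim: k => [|k IHk]; first exact: deg_le1.
by rewrite exprS mulSn; exact: deg_leM.
Qed.

(** The N ^ l monomials in the y_i with exponents below N have degree at most
    l N m, where m bounds the degrees of the y_i, so they live in a space of
    dimension (l N m + 1) ^ n, which is less than N ^ l for large N. *)
Lemma alg_dependent l (y : 'I_l -> S) : (n < l)%N ->
  exists N (v : {ffun 'I_l -> 'I_N} -> K),
    (exists a, v a != 0) /\ \sum_a v a *: \prod_i y i ^+ a i = 0.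
Proof.
move=> nl.
pose m := (\max_(i < l) msize (y i))%N.
have ym i : deg_le m (y i).
  by move=> a /msize_mdeg_lt /ltnW /leq_trans; apply; rewrite /m; exact: leq_bigmax.
(* (l N m + 1) ^ n <= (l m + 1) ^ n * N ^ n < N ^ (n + 1) <= N ^ l *)
pose N := ((l * m).+1 ^ n).+1; pose D := (l * N * m).+1.
have ND : (D ^ n < N ^ l)%N.
  apply: leq_ltn_trans (_ : ((l * m).+1 * N) ^ n < _)%N.
    have DN : (D <= (l * m).+1 * N)%N by rewrite /D /N; nia.
    by case: (posnP n) => [->|n_gt0]; rewrite ?expn0 ?leq_exp2r.
  rewrite expnMn; apply: leq_trans (_ : N ^ n.+1 <= _)%N.
    by rewrite expnS ltn_pmul2r ?expn_gt0.
  by rewrite leq_pexp2l.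
exists N.
pose mon (b : {ffun 'I_n -> 'I_D}) : 'X_{1..n} := [multinom (b i : nat) | i < n].
pose w (a : {ffun 'I_l -> 'I_N}) := \prod_i y i ^+ a i.
have wD a : deg_le (l * N * m) (w a).
  have : deg_le (\sum_(i < l) N * m) (w a).
    apply: (big_ind2 deg_le); [exact: deg_le1|by move=> *; exact: deg_leM|].
    move=> i _ b /(deg_leX (ym i)) /leq_trans; apply.
    by rewrite leq_mul2r ltnW ?orbT.
  by rewrite sum_nat_const card_ord mulnA.
pose A := \matrix_(a < #|{ffun 'I_l -> 'I_N}|, b < #|{ffun 'I_n -> 'I_D}|)
  (w (enum_val a))@_(mon (enum_val b)).
have /rowV0Pn[u uA u0] : kermx A != 0.
  rewrite kermx_eq0 /row_free; apply: contraTneq ND => rA.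
  rewrite -leqNgt; have := rank_leq_col A; rewrite rA !card_ffun !card_ord.
  by [].
exists (fun a => u 0 (enum_rank a)); split.
  have /rV0Pn[i ui] := u0; exists (enum_val i); by rewrite enum_valK.
apply/mpolyP => k; rewrite mcoeff0 raddf_sum /=.
have [kD|kD] := leqP (mdeg k) (l * N * m); last first.
  rewrite big1 // => a _; rewrite mcoeffZ -/(w a) memN_msupp_eq0 ?mulr0 //.
  by apply/negP => /wD; rewrite leqNgt kD.
have k_lt i : (k i < D)%N.
  by rewrite ltnS; apply: leq_trans kD; rewrite mdegE (bigD1 i) //= leq_addr.
have -> : k = mon [ffun i => Ordinal (k_lt i)].
  by apply/mnmP => i; rewrite mnmE ffunE.
move: uA => /sub_kermxP /matrixP /(_ 0 (enum_rank [ffun i => Ordinal (k_lt i)])).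
rewrite !mxE => uA0; rewrite -[RHS]uA0 (reindex_onto enum_val enum_rank) => [|a _]; last exact: enum_rankK.
apply: eq_big => [i|i _]; first by rewrite enum_valK eqxx.
by rewrite !mxE enum_rankK enum_valK mcoeffZ.
Qed.

End AlgebraicDependence.

Lemma prime_chain_bound (K : fieldType) n (R : comNzRingType)
    (iota : {rmorphism K -> R}) (phi : {rmorphism R -> {mpoly K[n]}}) l :
  injective phi -> (forall c, phi (iota c) = c%:MP) ->
  has_prime_chain R l -> (l <= n)%N.
Proof.
move=> phi_inj phi_iota [P [Pprime Pstep]]; rewrite leqNgt; apply/negP => nl.
have /choice[x xP] (i : 'I_l) : exists x, x \in P i.+1 /\ x \notin P i.
  by have [_ [x ? ?]] := Pstep i (ltn_ord i); exists x.
have [N [v [[a va] sum0]]] := alg_dependent (phi \o x) nl.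
case/eqP: va; move: a; apply: (@prime_chain_alg_indep _ _ iota l P x _
  (fun (a : {ffun 'I_l -> 'I_N}) i => a i : nat)) => //.
- by move=> i /Pstep[].
- by move=> b b' _ _ eb; apply/ffunP => i; apply: val_inj; exact: eb.
rewrite (_ : \sum_j _ = 0); first by apply: prime_ideal0; exact: Pprime.
apply: phi_inj; rewrite rmorph0 -[RHS]sum0 rmorph_sum; apply: eq_bigr => b _.
rewrite rmorphM /= phi_iota mul_mpolyC rmorph_prod; congr (_ *: _).
by apply: eq_bigr => i _; rewrite rmorphXn.
Qed.

Lemma kernel_prime_ideal (R : comNzRingType) (T : idomainType)
    (g : {rmorphism R -> T}) : prime_ideal [pred x | g x == 0].
Proof.
split; first split; rewrite ?inE ?rmorph0 ?rmorph1 ?oner_eq0 //.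
- by move=> a u v; rewrite !inE rmorphD rmorphM => /eqP-> /eqP->; rewrite mulr0 addr0.
- by move=> u v; rewrite !inE rmorphM mulf_eq0.
Qed.

Lemma krull_dimE (R : comNzRingType) l :
  has_prime_chain R l -> (forall l', has_prime_chain R l' -> (l' <= l)%N) ->
  krull_dim R = l.
Proof.
move=> Rl maxl; apply: xget_unique => // k [Rk maxk].
by apply/eqP; rewrite eqn_leq maxl ?maxk.
Qed.

(** * The fiber cone of an equigenerated monomial ideal *)

Section FiberCone.
Variables (K : fieldType) (n d : nat) (M : set 'X_{1..n}).
Local Notation S := {mpoly K[n]}.
Local Notation I := (mon_ideal K M).

(** The pairs (k, a) such that X^a t^k belongs to the Rees algebra. *)
Definition semigroup_of k a : Prop := exists2 b, mon_pow M k b & (b <= a)%MM.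

(** A face is a subset F of the semigroup with x + y in F exactly when x and y
    are in F. [face_deg] restricts to the faces of the fiber cone, that is, to
    those avoiding every X^a t^k in m I^k. *)
Record face := Face {
  face_pred :> nat -> pred 'X_{1..n};
  face00 : face_pred 0%N 0%MM;
  faceD : forall j k a b, semigroup_of j a -> semigroup_of k b ->
    face_pred (j + k)%N (a + b)%MM = face_pred j a && face_pred k b;
  face_deg : forall k a, face_pred k a -> mdeg a = (d * k)%N
}.

Hypothesis M_deg : forall m, M m -> mdeg m = d.

Lemma mon_pow_deg k b : mon_pow M k b -> mdeg b = (d * k)%N.
Proof.
elim: k b => [|k IHk] b /=; first by move->; rewrite mdeg0 muln0.
by move=> [m /M_deg mm [c /IHk cc <-]]; rewrite mdegD mm cc mulnS.
Qed.

Lemma rees_semigroup (p : rees I) k a :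
  a \in msupp (p : {poly S})`_k -> semigroup_of k a.
Proof.
have /asboolP /(_ k) := valP p.
by rewrite mon_ideal_exp => /mon_idealP Ip /Ip.
Qed.

(** A monomial of I^k of degree greater than d k is a proper multiple of a
    generator of I^k, hence divisible by some X_i times this generator. *)
Lemma fiber_idealP (p : rees I) :
  (p \in fiber_ideal I) <->
  (forall k a, a \in msupp (p : {poly S})`_k -> (d * k < mdeg a)%N).
Proof.
split=> [/asboolP pF k a|pF].
  have := pF k; rewrite max_idealE mon_ideal_exp mon_ideal_mul.
  move=> /mon_idealP + ap => /(_ a ap)[_ [_ [i _ <-] [b Mb <-]] /submK <-].
  by rewrite !mdegD mdeg1 (mon_pow_deg Mb); lia.
apply/asboolP => k.
rewrite max_idealE mon_ideal_exp mon_ideal_mul; apply/mon_idealP => a ap.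
have [b Mb ba] := rees_semigroup ap.
have [i abi] : exists i, (0 < (a - b)%MM i)%N.
  apply/existsP; apply: contraT; rewrite negb_exists => /forallP ab0.
  have ab : a = b.
    rewrite -(submK ba); apply/mnmP => i; rewrite mnmDE.
    by have := ab0 i; rewrite -eqn0Ngt => /eqP->.
  by have := pF k a ap; rewrite ab (mon_pow_deg Mb) ltnn.
exists (U_(i) + b)%MM; first by exists U_(i)%MM; [exists i|exists b].
apply/mnm_lepP => j; have /mnm_lepP/(_ j) := ba; move: abi.
by rewrite mnmDE mnmBE mnm1E; case: eqP => [<-|_]; lia.
Qed.

Section FaceProjection.
Variable C : face.

(** Deleting the monomials outside a face is a ring morphism: these monomials
    span an ideal, and the face is closed under addition. *)
Definition face_proj (p : rees I) : {poly S} :=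
  \poly_(k < size (p : {poly S})) mrestr (C k) (p : {poly S})`_k.

Lemma coef_face_proj p k : (face_proj p)`_k = mrestr (C k) (p : {poly S})`_k.
Proof.
by rewrite coef_poly; case: ltnP => // pk; rewrite nth_default ?raddf0.
Qed.

Fact face_proj_is_zmod_morphism : zmod_morphism face_proj.
Proof.
by move=> p q; apply/polyP => k; rewrite coefB !coef_face_proj coefB raddfB.
Qed.

Fact face_proj_is_monoid_morphism : monoid_morphism face_proj.
Proof.
split=> [|p q]; apply/polyP => k; rewrite coef_face_proj.
  rewrite !coef1; case: k => [|k] /=; last by rewrite mulr0n raddf0.
  by have := mrestrX K (C 0%N) 0%MM; rewrite mpolyX0 face00.
rewrite !coefM raddf_sum /=; apply: eq_bigr => i _.
rewrite !coef_face_proj; apply: mrestr_mul => a b ap bq.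
by rewrite -faceD ?subnKC ?leq_ord //; [exact: rees_semigroup ap|exact: rees_semigroup bq].
Qed.

HB.instance Definition _ :=
  GRing.isZmodMorphism.Build (rees I) {poly S} face_proj face_proj_is_zmod_morphism.
HB.instance Definition _ :=
  GRing.isMonoidMorphism.Build (rees I) {poly S} face_proj face_proj_is_monoid_morphism.

Lemma face_proj_fiber_ideal p : p \in fiber_ideal I -> face_proj p = 0.
Proof.
move=> /fiber_idealP pF; apply/polyP => k; rewrite coef_face_proj coef0.
apply/mpolyP => a; rewrite mcoeff_mrestr mcoeff0; case: ifP => // /face_deg da.
by apply: memN_msupp_eq0; apply/negP => /pF; rewrite da ltnn.
Qed.

Local Open Scope quotient_scope.

(** The morphism induced by [face_proj] on the quotient. *)
Definition cone_face_proj (x : fiber_cone I) : {poly S} := face_proj (repr x).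

Lemma cone_face_proj_pi (p : rees I) :
  cone_face_proj (\pi_{ideal_quot (fiber_ideal I)} p) = face_proj p.
Proof.
apply/eqP; rewrite -subr_eq0 -rmorphB.
by apply/eqP/face_proj_fiber_ideal; rewrite Quotient.idealrBE reprK.
Qed.

Fact cone_face_proj_is_zmod_morphism : zmod_morphism cone_face_proj.
Proof.
move=> x y; rewrite -[x]reprK -[y]reprK -rmorphB !cone_face_proj_pi.
by rewrite rmorphB.
Qed.

Fact cone_face_proj_is_monoid_morphism : monoid_morphism cone_face_proj.
Proof.
split=> [|x y].
  by rewrite -(rmorph1 \pi_{ideal_quot (fiber_ideal I)}) cone_face_proj_pi rmorph1.
by rewrite -[x]reprK -[y]reprK -rmorphM !cone_face_proj_pi rmorphM.
Qed.

HB.instance Definition _ := GRing.isZmodMorphism.Build (fiber_cone I) {poly S}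
  cone_face_proj cone_face_proj_is_zmod_morphism.
HB.instance Definition _ := GRing.isMonoidMorphism.Build (fiber_cone I) {poly S}
  cone_face_proj cone_face_proj_is_monoid_morphism.

End FaceProjection.

Lemma cone_face_proj_sub (C D : face) (x : fiber_cone I) :
  (forall k a, D k a -> C k a) -> cone_face_proj C x = 0 -> cone_face_proj D x = 0.
Proof.
move=> DC Cx; apply/polyP => k; rewrite coef_face_proj coef0.
have := congr1 (fun p : {poly S} => p`_k) Cx; rewrite coef_face_proj coef0 => Ck.
apply/mpolyP => a; rewrite mcoeff_mrestr mcoeff0; case: ifP => // /DC Ca.
by have := congr1 (mcoeff a) Ck; rewrite mcoeff_mrestr Ca mcoeff0.
Qed.

Fact rees_gen_subproof m : M m -> ('X_[m] : S)%:P * 'X \in rees_pred I.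
Proof.
move=> Mm; apply/asboolP => k; rewrite coefMX mon_ideal_exp; case: k => [|k].
  exact: ideal_gen0.
rewrite coefC; case: k => [|k] /=; last exact: ideal_gen0.
apply: mem_ideal_gen; exists m => //.
by exists m => //; exists 0%MM; rewrite ?addm0.
Qed.

(** The class of X^m t. *)
Definition cone_gen m (Mm : M m) : fiber_cone I :=
  (\pi_{ideal_quot (fiber_ideal I)} (Rees (rees_gen_subproof Mm)))%qT.

Lemma cone_face_proj_gen (C : face) m (Mm : M m) :
  (cone_face_proj C (cone_gen Mm) == 0) = ~~ C 1%N m.
Proof.
rewrite cone_face_proj_pi; apply/eqP/idP => [|Cm].
  move=> /(congr1 (fun p : {poly S} => p`_1)); rewrite coef_face_proj coefMX coefC /=.
  rewrite mrestrX coef0; case: ifP => // _ /(congr1 (mcoeff m)).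
  by rewrite mcoeffX eqxx mcoeff0 => /eqP; rewrite oner_eq0.
apply/polyP => k; rewrite coef_face_proj coefMX coefC coef0.
by case: k => [|[|k]] /=; rewrite ?raddf0 // mrestrX (negPf Cm).
Qed.

Fact rees_const_subproof (c : K) : (c%:MP : S)%:P \in rees_pred I.
Proof.
apply/asboolP => k; rewrite coefC; case: k => [|k] //=.
by have [] := ideal_exp_closed I k.+1.
Qed.

Definition rees_const c := Rees (rees_const_subproof c).

Fact rees_const_is_zmod_morphism : zmod_morphism rees_const.
Proof. by move=> a b; apply: val_inj; rewrite /= !rmorphB. Qed.

Fact rees_const_is_monoid_morphism : monoid_morphism rees_const.
Proof. by split=> [|a b]; apply: val_inj; rewrite /= ?rmorph1 ?rmorphM. Qed.

HB.instance Definition _ := GRing.isZmodMorphism.Build K (rees I)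
  rees_const rees_const_is_zmod_morphism.
HB.instance Definition _ := GRing.isMonoidMorphism.Build K (rees I)
  rees_const rees_const_is_monoid_morphism.

Definition total_face_pred k := [pred a : 'X_{1..n} | mdeg a == (d * k)%N].

Fact total_face00 : total_face_pred 0%N 0%MM.
Proof. by rewrite /= mdeg0 muln0. Qed.

Lemma semigroup_of_deg k a : semigroup_of k a -> (d * k <= mdeg a)%N.
Proof.
by move=> [b /mon_pow_deg <- /submK <-]; rewrite mdegD leq_addl.
Qed.

Fact total_faceD j k a b : semigroup_of j a -> semigroup_of k b ->
  total_face_pred (j + k)%N (a + b)%MM = total_face_pred j a && total_face_pred k b.
Proof.
move=> /semigroup_of_deg ja /semigroup_of_deg kb; rewrite /= mdegD mulnDr.
by apply/eqP/andP => [|[/eqP-> /eqP->]] //; split; apply/eqP; lia.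
Qed.

Fact total_face_deg k a : total_face_pred k a -> mdeg a = (d * k)%N.
Proof. by move/eqP. Qed.

Definition total_face := Face total_face00 total_faceD total_face_deg.

(** Keep the part of degree d k of the coefficient of t^k, and set t = 1: this
    identifies the fiber cone with the subalgebra of S generated by the
    monomials X^m, m in M. *)
Definition toric_map : {rmorphism fiber_cone I -> S} :=
  horner_eval (1 : S) \o cone_face_proj total_face.

(** As d > 0, the degree of a monomial determines the power of t it comes with,
    so that no cancellation occurs when t is set to 1. *)
Lemma toric_map_inj : (0 < d)%N -> injective toric_map.
Proof.
move=> d_gt0; apply: raddf_inj => x; rewrite -[x]reprK /= cone_face_proj_pi.
set p := repr x; rewrite /horner_eval => sum0.
suff pF : p \in fiber_ideal I.
  apply/eqP; rewrite -(rmorph0 \pi_{ideal_quot (fiber_ideal I)})%qT.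
  by rewrite -Quotient.idealrBE subr0.
apply/fiber_idealP => k a ap.
have ka := semigroup_of_deg (rees_semigroup ap).
rewrite ltn_neqAle ka andbT; apply/negP => /eqP da.
have kp : (k < size (p : {poly S}))%N.
  by rewrite ltnNge; apply: contraTN ap => /(nth_default 0)->; rewrite msupp0.
move: ap => /[!mcoeff_msupp]/eqP; apply.
have sz : (size (face_proj total_face p) <= size (p : {poly S}))%N by exact: size_poly.
rewrite (horner_coef_wide _ sz) in sum0.
have := congr1 (mcoeff a) sum0; rewrite mcoeff0 => sum0a.
rewrite -[RHS]sum0a raddf_sum /= (bigD1 (Ordinal kp)) //=.
rewrite expr1n mulr1 coef_face_proj mcoeff_mrestr /= -da eqxx big1 ?addr0 // => i ik.
rewrite expr1n mulr1 coef_face_proj mcoeff_mrestr /= -da eqn_pmul2l // ifN //.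
by rewrite eq_sym.
Qed.

Lemma toric_map_const c :
  toric_map (\pi_{ideal_quot (fiber_ideal I)} (rees_const c))%qT = c%:MP.
Proof.
rewrite /= cone_face_proj_pi /horner_eval (_ : face_proj _ _ = c%:MP%:P) ?hornerC //.
apply/polyP => k; rewrite coef_face_proj /= !coefC; case: eqP => [->|_]; last exact: raddf0.
apply/mpolyP => a; rewrite mcoeff_mrestr mcoeffC /= muln0 mdeg_eq0.
by case: eqP; rewrite ?mulr0.
Qed.

Lemma krull_dim_fiber_cone_le l :
  (0 < d)%N -> has_prime_chain (fiber_cone I) l -> (l <= n)%N.
Proof.
move=> d_gt0; pose iota : {rmorphism K -> fiber_cone I} :=
  \pi_{ideal_quot (fiber_ideal I)}%qT \o rees_const.
exact: (@prime_chain_bound _ _ _ iota toric_map) (toric_map_inj d_gt0) toric_map_const.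
Qed.

(** The primes are the kernels of the projections onto the faces; a generator
    lying in one face and not in the next one makes the inclusion strict. *)
Lemma face_flag_prime_chain l (C : nat -> face) :
  (forall i k a, C i.+1 k a -> C i k a) ->
  (forall i, (i < l)%N -> exists m, [/\ M m, C i 1%N m & ~~ C i.+1 1%N m]) ->
  has_prime_chain (fiber_cone I) l.
Proof.
move=> C_sub C_step.
exists (fun i => [pred x | cone_face_proj (C i) x == 0] : {pred fiber_cone I}); split=> [i _|i il].
  exact: kernel_prime_ideal.
split=> [x|].
  by rewrite !inE => /eqP Cx; apply/eqP/(cone_face_proj_sub _ Cx)/C_sub.
have [m [Mm Cm Cm']] := C_step i il.
by exists (cone_gen Mm); rewrite inE cone_face_proj_gen ?negbK.
Qed.

End FiberCone.

(** * The analytic spread of the squarefree Veronese ideal *)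

Section VeroneseSpread.
Variables (K : fieldType) (n d : nat).
Hypothesis d_bounds : (1 <= d <= n - 1)%N.
Local Notation M := [set mesym1 A | A in [set` subsets_of_card n d]].

Lemma squarefree_mnm_deg m : M m -> mdeg m = d.
Proof. by move=> [A /= + <-]; rewrite inE mdeg_mesym1 => /eqP. Qed.

(** Every (k, a) in the semigroup with deg a = d k satisfies 0 <= a_i <= k, and
    both a_i = 0 and a_i = k cut out a face. The first d - 1 coordinates are
    successively set to k and the following ones to 0. After n steps the degree
    d k is at most (d - 1) k, which leaves k = 0 only: the last face yields the
    irrelevant maximal ideal. *)
Definition veronese_face_pred r k := [pred a : 'X_{1..n} | (mdeg a == (d * k)%N) &&
  [forall i : 'I_n, (i < r)%N ==> (a i == if (i < d.-1)%N then k else 0%N)]].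

Lemma mon_pow_le k b i : mon_pow M k b -> (b i <= k)%N.
Proof.
elim: k b => [|k IHk] b /=; first by move=> ->; rewrite mnm0E.
by move=> [_ [A _ <-] [c /IHk ck <-]]; rewrite !mnmE; case: (_ \in _); lia.
Qed.

Lemma semigroup_of_le k a i :
  semigroup_of M k a -> mdeg a = (d * k)%N -> (a i <= k)%N.
Proof.
move=> [b Mb ba] da; suff -> : a = b by exact: mon_pow_le Mb.
rewrite -(submK ba) in da *; move: da.
rewrite mdegD (mon_pow_deg squarefree_mnm_deg Mb) => /eqP.
by rewrite -[X in _ == X]add0n eqn_add2r mdeg_eq0 => /eqP->; rewrite add0m.
Qed.

Fact veronese_face00 r : veronese_face_pred r 0%N 0%MM.
Proof.
rewrite /= mdeg0 muln0 eqxx; apply/forallP => i; rewrite mnm0E if_same eqxx.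
exact: implybT.
Qed.

Fact veronese_faceD r j k a b : semigroup_of M j a -> semigroup_of M k b ->
  veronese_face_pred r (j + k)%N (a + b)%MM =
  veronese_face_pred r j a && veronese_face_pred r k b.
Proof.
move=> ja kb; have aj := semigroup_of_le _ ja; have bk := semigroup_of_le _ kb.
apply/andP/andP => -[].
  rewrite mdegD mulnDr => /eqP dab /forallP ab.
  have da := semigroup_of_deg squarefree_mnm_deg ja.
  have db := semigroup_of_deg squarefree_mnm_deg kb.
  have da' : mdeg a = (d * j)%N by lia.
  have db' : mdeg b = (d * k)%N by lia.
  rewrite /= da' db' !eqxx; split; apply/forallP => i; apply/implyP => ir;
  have := ab i; rewrite ir mnmDE /=; have := aj i da'; have := bk i db';
  by case: ifP => _; lia.
move=> /andP[/eqP da /forallP a_r] /andP[/eqP db /forallP b_r]; split.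
  by rewrite mdegD da db mulnDr.
apply/forallP => i; apply/implyP => ir; have := a_r i; have := b_r i.
by rewrite ir mnmDE /= => /eqP-> /eqP->; case: ifP.
Qed.

Fact veronese_face_deg r k a : veronese_face_pred r k a -> mdeg a = (d * k)%N.
Proof. by move=> /andP[/eqP]. Qed.

Definition veronese_face r :=
  Face (@veronese_face00 r) (@veronese_faceD r) (@veronese_face_deg r).

(** The squarefree monomial separating face r from face r + 1 is that of
    {0, ..., d} minus r if r < d - 1, and of {0, ..., d - 2} plus r otherwise. *)
Lemma veronese_face_step r : (r < n)%N ->
  exists m, [/\ M m, veronese_face r 1%N m & ~~ veronese_face r.+1 1%N m].
Proof.
move=> rn; pose i0 := Ordinal rn; case/andP: d_bounds => d_gt0 dn.
suff [A Ad [Alow Ar]] : exists2 A : {set 'I_n}, #|A| = d &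
    (forall i : 'I_n, (i < r)%N -> (i \in A) = (i < d.-1)%N) /\
    (i0 \in A) = (d.-1 <= r)%N.
  exists (mesym1 A); split; first by exists A; rewrite //= inE Ad.
    rewrite /= mdeg_mesym1 Ad muln1 eqxx /=; apply/forallP => i; apply/implyP => ir.
    by rewrite mnmE Alow //; case: ifP.
  rewrite /= negb_and; apply/orP; right; apply/forallPn; exists i0.
  by rewrite ltnSn mnmE Ar /= leqNgt; case: ifP.
have card_lt m : (m <= n)%N -> #|[set i : 'I_n | (i < m)%N]%SET| = m.
  by move=> mn; rewrite -sum1dep_card (big_ord_narrow mn) sum1_card card_ord.
have [rd|dr] := ltnP r d.-1.
  exists ([set i : 'I_n | (i < d.+1)%N] :\ i0)%SET.
    have dn' : (d.+1 <= n)%N by lia.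
    have i0d : (i0 < d.+1)%N by apply: leq_trans rd _; lia.
    by apply: succn_inj; rewrite -[RHS](card_lt _ dn') [RHS](cardsD1 i0) inE i0d add1n.
  split=> [i ir|]; rewrite !inE -?val_eqE /= ?eqxx //; lia.
exists (i0 |: [set i : 'I_n | (i < d.-1)%N])%SET.
  rewrite cardsU1 card_lt ?inE /=; first by rewrite -leqNgt dr add1n prednK.
  by rewrite (leq_trans (leq_pred d)) // (leq_trans dn) ?leq_subr.
by split=> [i ir|]; rewrite !inE -?val_eqE /= ?eqxx //; lia.
Qed.

Lemma analytic_spread_squarefree_veronese :
  analytic_spread (squarefree_veronese K n d) = n.
Proof.
have d_gt0 : (0 < d)%N by case/andP: d_bounds.
rewrite squarefree_veroneseE; apply: krull_dimE => [|l]; last first.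
  exact: krull_dim_fiber_cone_le squarefree_mnm_deg _ d_gt0.
apply: (face_flag_prime_chain K squarefree_mnm_deg (C := veronese_face)).
  move=> r k a /andP[da /forallP a_r]; apply/andP; split=> //.
  by apply/forallP => i; apply/implyP => ir; have := a_r i; rewrite ltnS ltnW.
exact: veronese_face_step.
Qed.

End VeroneseSpread.

(** * Comparing the two sides of the Freiman equation *)

Section FreimanNumerics.
Local Open Scope nat_scope.

Definition sqr_count n d := \sum_(j < d.+1) 'C(n, j) * 'C(n - j, 2 * (d - j)).

Lemma double_bin2 n : 2 * 'C(n, 2) = n * n.-1.
Proof. by rewrite -(mul_bin_diag n 1) bin1. Qed.

Lemma sqr_count1 n : sqr_count n 1 + 'C(n, 2) = n * 'C(n, 1).
Proof.
rewrite /sqr_count 2!big_ord_recr big_ord0 /= bin0 bin1 subn0 subnn bin0.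
have := double_bin2 n; rewrite (_ : 2 * (1 - 0) = 2) //.
case: n => [|n] //=; lia.
Qed.

(** Only the terms j = n - 2 and j = n - 1 of the sum are nonzero. *)
Lemma sqr_count_pred n : 1 < n ->
  sqr_count n (n - 1) + 'C(n, 2) = n * 'C(n, n - 1).
Proof.
case: n => [|[|m]] // _; rewrite subn1 /= /sqr_count 2!big_ord_recr /=.
rewrite big1 => [|j _]; last by rewrite (@bin_small (_ - j)) ?muln0 //; have := ltn_ord j; lia.
have -> : 'C(m.+2, m) = 'C(m.+2, 2) by rewrite -(@bin_sub m.+2 2) // !subSS subn0.
have e1 : m.+2 - m = 2 by rewrite -addn2 addKn.
have e2 : 2 * (m.+1 - m) = 2 by rewrite subSnn.
rewrite e1 e2 subnn muln0 bin0 binn binSn.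
have := double_bin2 m.+2; rewrite /=; lia.
Qed.

Lemma sqr_count_ge n e :
  'C(n, e.+2) + 'C(n, e.+1) * 'C(n - e.+1, 2) + 'C(n, e) * 'C(n - e, 4)
  <= sqr_count n e.+2.
Proof.
have e1 : 2 * (e.+2 - e.+1) = 2 by rewrite subSnn.
have e2 : 2 * (e.+2 - e) = 4 by lia.
rewrite /sqr_count 3!big_ord_recr /= e1 e2 subnn muln0 bin0 muln1.
set s := \sum_(_ < _) _.
by rewrite -!addnA addnC [X in X + _]addnC -addnA leq_addl.
Qed.

Lemma mid_term_count n e : e.+2 <= n ->
  2 * ('C(n, e.+1) * 'C(n - e.+1, 2)) = e.+2 * (n - e.+2) * 'C(n, e.+2).
Proof.
move=> en; rewrite mulnCA double_bin2 -subnS mulnA [_ * (n - e.+1)]mulnC.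
by rewrite -mul_bin_left mulnAC.
Qed.

(** Let B = C(n, d), let D = d (n - d), and let X be the term j = d - 2, so
    that twice the sum is at least (2 + D) B + 2 X. If d = 2 or n - d = 2, then
    D = 2 n - 4 and C(n, 2) = B, so that the two sides differ by X > 0 at least.
    Otherwise D >= 3 n - 9, which suffices for n >= 7 and leaves the case n = 6,
    d = 3. *)
Lemma sqr_count_gt n d : 2 <= d -> d + 2 <= n ->
  n * 'C(n, d) < sqr_count n d + 'C(n, 2).
Proof.
case: d => [|[|e]] // _ en.
have sq := sqr_count_ge n e.
have mid : 2 * ('C(n, e.+1) * 'C(n - e.+1, 2)) = e.+2 * (n - e.+2) * 'C(n, e.+2).
  by apply: mid_term_count; lia.
have X0 : 0 < 'C(n, e) * 'C(n - e, 4) by rewrite muln_gt0 !bin_gt0; lia.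
move: mid sq X0; move: ('C(n, e) * _) => X; move: ('C(n, e.+1) * _) => Y.
have [dn|dn] : (e = 0 \/ n = e.+2 + 2) \/ (1 <= e /\ e.+2 + 3 <= n) by lia.
  have -> : 'C(n, e.+2) = 'C(n, 2).
    by case: dn => [->//|nE]; rewrite -(@bin_sub n 2) ?nE ?addnK; lia.
  have dnd : e.+2 * (n - e.+2) + 4 = 2 * n by case: dn => nE; rewrite nE; lia.
  move: (e.+2 * _) dnd ('C(n, 2)) (sqr_count _ _) => D dnd B s; nia.
have [n7|n6] := leqP 7 n.
  have dnd : 3 * n <= e.+2 * (n - e.+2) + 9 by nia.
  have : 0 < 'C(n, 2) by rewrite bin_gt0; lia.
  move: (e.+2 * _) dnd 'C(n, e.+2) ('C(n, 2)) (sqr_count _ _) => D dnd B A s; nia.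
have [-> ->] : n = 6 /\ e = 1 by lia.
rewrite (_ : 'C(6, 3) = 20) // (_ : 'C(6, 2) = 15) //.
by move: (sqr_count _ _) => s; lia.
Qed.

End FreimanNumerics.

Lemma freiman_squarefree_veroneseE (K : fieldType) (n d : nat) :
  (1 <= d <= n - 1)%N ->
  freiman (squarefree_veronese K n d) <->
  (sqr_count n d + 'C(n, 2) = n * 'C(n, d))%N.
Proof.
move=> hd; rewrite /freiman mu_squarefree_veronese_sqr mu_squarefree_veronese.
rewrite analytic_spread_squarefree_veronese // -/(sqr_count n d).
split=> [[_]|sq]; first by move: (sqr_count n d) 'C(n, d) 'C(n, 2) => s b c; lia.
split; last by move: sq; move: (sqr_count n d) 'C(n, d) 'C(n, 2) => s b c; lia.
by exists d, [set b : 'X_{1..n} | mdeg b = d /\ forall i, (b i <= 1)%N]; split=> // m [].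
Qed.

Theorem theorem3p5 (K : fieldType) (n d : nat) (hd : (1 <= d <= n - 1)%N) :
  freiman (squarefree_veronese K n d) <-> (d = 1%N \/ d = (n - 1)%N).
Proof.
rewrite freiman_squarefree_veroneseE //; split=> [sq|[->|->]].
- have [d2|] := ltnP 1 d; last lia.
  have [dn|] := leqP (d + 2) n; last lia.
  by have := sqr_count_gt d2 dn; rewrite sq ltnn.
- exact: sqr_count1.
- by apply: sqr_count_pred; lia.
Qed.
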